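(* Let $F$ be a finite field and $G$ a finite abelian group. Then there exist $n\geq 2$ and a faithful representation (injective group homomorphism) $G\rightarrow GL_n(F)$ of degree $n$ over $F$ whose image consists entirely of invertible $n\times n$ Christoffel matrices over $F$. In particular (taking $F=\mathbb{F}_2=\{0,1\}$), $G$ admits a linear representation over $\mathbb{F}_2$ consisting of $|G|$-many distinct $n\times n$ invertible Christoffel matrices over $\{0,1\}$, for some $n\geq 2$.
   Context: For $n\geq 2$, $(\mathbb{Z}/n\mathbb{Z})^\times$ denotes the multiplicative group of integers modulo $n$, identified with the set of integers in $\{0,1,\dots,n-1\}$ coprime to $n$. A binary word on two distinct symbols $a,b$ (ordered formally by $a<b$) is a Christoffel word if it is Lyndon (strictly smaller lexicographically than all its other cyclic conjugates) and cyclically balanced (any two cyclic factors of the same length have numbers of occurrences of $a$ differing by at most $1$). For $m\in(\mathbb{Z}/n\mathbb{Z})^\times$, $c_m(a,b)$ denotes the Christoffel word of length $n$ on the distinct symbols $a,b$, beginning in $a$, with exactly $m$ occurrences of $a$ and $n-m$ occurrences of $b$. The Christoffel matrix $C_m(a,b)$ of size $n$ and type $m$ is the $n\times n$ matrix whose rows are the $n$ cyclic conjugates of $c_m(a,b)$ arranged in increasing lexicographic order (relative to $a<b$), so that its first row is $c_m(a,b)$. Equivalently: the first column of $C_m(a,b)$ consists of $m$ entries $a$ followed by $n-m$ entries $b$, and each subsequent column is the cyclic downward shift by $m$ positions of the preceding column. An $n\times n$ Christoffel matrix over $F$ is a matrix $C_m(a,b)$ with $m\in(\mathbb{Z}/n\mathbb{Z})^\times$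 and $a,b\in F$, $a\neq b$ (the order $a<b$ is purely formal). *)

(* Defs.v *)
From HB Require Import structures.
From mathcomp Require Import all_boot all_order all_fingroup all_algebra.
From mathcomp Require Import all_character.

Set Implicit Arguments.
Unset Strict Implicit.
Unset Printing Implicit Defensive.

Import Order.TTheory.

(* A word on two formal symbols a < b is a sequence of booleans, where [false] *)
(* stands for a and [true] for b: the order of [bool] is [false < true], and   *)
(* [seqlexi bool] is [seq bool] with the lexicographic order.  The actual      *)
(* values of a and b are substituted only when a matrix is formed.             *)
Definition word := seqlexi bool.

(* Conjugates are indexed by rotation amounts, so a proper power, which equals *)
(* one of its nontrivial rotations, is not Lyndon.                             *)
Definition lyndon (w : word) : Prop :=
  forall k : nat, 0 < k < size w -> (w < (rot k w : word))%O.

(* The cyclic factor of w of length l starting at position i is                *)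
(* [take l (rot i w)].                                                         *)
Definition cyclically_balanced (w : word) : Prop :=
  forall i j l : nat, i < size w -> j < size w -> l <= size w ->
    count_mem false (take l (rot i w))
      <= (count_mem false (take l (rot j w))).+1.

Definition christoffel_word (w : word) : Prop :=
  lyndon w /\ cyclically_balanced w.

(* w is the Christoffel word c_m(a, b) of length n. *)
Definition christoffel_word_of (n m : nat) (w : word) : Prop :=
  [/\ christoffel_word w,
      size w = n,
      head true w = false,
      count_mem false w = m
    & count_mem true w = n - m].

Definition sorted_conjugates (w : word) : seq word :=
  sort (fun u v : word => (u <= v)%O) [seq (rot k w : word) | k <- iota 0 (size w)].

Definition conjugates_mx (T : Type) (n : nat) (w : word) (a b : T) : 'M[T]_n :=
  \matrix_(i < n, j < n)
    if nth false (nth [::] (sorted_conjugates w) i) j then b else a.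

(* A unit of Z/nZ is given by its representative m < n coprime to n. *)
Definition is_christoffel_mx (F : fieldType) (n : nat) (A : 'M[F]_n) : Prop :=
  exists (m : nat) (w : word) (a b : F),
    [/\ m < n, coprime m n, christoffel_word_of n m w, a != b
      & A = conjugates_mx n w a b].

(* Main.v *)
Require Import Defs.
From HB Require Import structures.
From mathcomp Require Import all_boot all_order all_fingroup all_algebra.
From mathcomp Require Import all_character finfield cyclic gproduct abelian.
From mathcomp Require Import zify ring.

Set Implicit Arguments.
Unset Strict Implicit.
Unset Printing Implicit Defensive.

Import Order.TTheory GRing.Theory.

(** The idea. Let n >= 2 be invertible in F. The entry of C_m(a, b) in row i and
    column j is a when (i - m j) mod n < m and b otherwise, so C_m(a, b) is a
    constant matrix plus (a - b) P_m, where P_m = C_m(1, 0). Row i of P_m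
    records the times at which the rotation r |-> r - m of Z/nZ, started at i,
    is in the interval [0, m), which are exactly the times at which it wraps
    around 0. Over l steps a starting point r is therefore related to its end
    point r' by the conservation law
        n * (number of visits to [0, m)) + r = r' + m * l
    ([count_rotation_word]). This one identity gives

    - the balance of the row words: the number of visits in l steps differs by
      less than 2 between two starting points ([rotation_word_balanced]);

    - the product formula P_u P_v = (uv / n) J + P_(uv mod n), where uv / n is
      the Euclidean quotient and J the matrix of ones, because an entry of
      P_u P_v counts the visits of a rotation by u during v consecutive steps
      ([sum_christoffel_row_col]).

    Rows and columns of P_u sum to u, so the product of two matrices of the form
    x J + P_u is again of this form, and the factor x J is pinned down by the
    row sum, which is multiplicative. Choosing x = (1 - u) / n makes all row sums
    equal to 1, hence u |-> x J + P_u is multiplicative on Z/nZ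
    ([normalized_christoffel_mxM]) and gives a faithful representation of the
    units of Z/nZ by Christoffel matrices with a - b = 1.

    That these matrices are Christoffel in the sense of sorted conjugates rests
    on two facts: for a unit u the conjugates of row 0 are exactly the rows, and
    rows increase lexicographically, since two rotations keep their distance as
    long as they read the same letters ([rotation_word_lt]).

    It remains to embed a finite abelian group in the units of Z/nZ for some n
    prime to the characteristic. No primes in arithmetic progressions are
    required: modulo N = 1 + u + ... + u^(d-1) the integer u has order d, and N
    is prime to any prescribed M that divides u ([unit_of_order]). Cyclic factors
    are thus embedded one by one with pairwise coprime moduli and assembled by
    the Chinese remainder theorem ([abelian_embeds_mod]). *)

(** * Words coding a rotation of Z/nZ *)

(** The first l letters read along the orbit r, r - u, r - 2u, ..., with letter a
    on the interval [0, u). *)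
Fixpoint rotation_word n (u r : 'I_n.+2) (l : nat) : word :=
  if l is l'.+1 then (u <= r) :: rotation_word u (r - u)%R l' else [::].

Lemma size_rotation_word n (u r : 'I_n.+2) l : size (rotation_word u r l) = l.
Proof. by elim: l r => //= l IH r; rewrite IH. Qed.

Lemma nth_rotation_word n (u r : 'I_n.+2) l t : t < l ->
  nth false (rotation_word u r l) t = (u <= (r - u *+ t)%R).
Proof.
elim: l r t => // l IH r [|t] lt_tl; first by rewrite mulr0n subr0.
by rewrite [LHS]/= IH // mulrS opprD addrA.
Qed.

Lemma rotation_word_cat n (u r : 'I_n.+2) k l :
  rotation_word u r (k + l)
    = rotation_word u r k ++ rotation_word u (r - u *+ k)%R l.
Proof.
elim: k r => [|k IH] r; first by rewrite mulr0n subr0.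
by rewrite /= IH mulrS opprD addrA.
Qed.

Lemma take_rotation_word n (u r : 'I_n.+2) k l : k <= l ->
  take k (rotation_word u r l) = rotation_word u r k.
Proof.
move=> /subnKC<-.
by rewrite rotation_word_cat take_size_cat ?size_rotation_word.
Qed.

Lemma mulrn_order_Zp n (u : 'I_n.+2) : (u *+ n.+2 = 0)%R.
Proof. by rewrite -mulr_natr (@pchar_Zp n.+2) ?mulr0. Qed.

Lemma rot_rotation_word n (u r : 'I_n.+2) k : k <= n.+2 ->
  rot k (rotation_word u r n.+2) = rotation_word u (r - u *+ k)%R n.+2.
Proof.
move=> le_kn; have := subnKC le_kn; set l := n.+2 - k => Ekl.
have Erl : (r - u *+ k - u *+ l = r)%R.
  by rewrite -addrA -opprD -mulrnDr Ekl mulrn_order_Zp subr0.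
rewrite -{1}Ekl rotation_word_cat -{1}(size_rotation_word u r k) rot_size_cat.
by rewrite -[in RHS]Ekl addnC rotation_word_cat Erl.
Qed.

(** Subtracting u wraps around 0 exactly at the points that are coded by a. *)
Lemma val_subr_Zp n (u r : 'I_n.+2) :
  (r - u)%R + u = (r < u) * n.+2 + r :> nat.
Proof.
case: u r => u lt_un [r lt_rn]; rewrite /= modnDmr.
case: ltnP => [lt_ru | le_ur] /=; first by rewrite modn_small; lia.
have -> : r + (n.+2 - u) = (r - u) + n.+2 by lia.
by rewrite modnDr modn_small; lia.
Qed.

(** Each step moves the point down by u, except that reading the letter a also
    lifts it by n; summing over l steps gives this conservation law. *)
Lemma count_rotation_word n (u r : 'I_n.+2) l :
  count_mem false (rotation_word u r l) * n.+2 + r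
    = (r - u *+ l)%R + u * l.
Proof.
elim: l r => [|l IH] r; first by rewrite mulr0n subr0 muln0 addn0.
rewrite [rotation_word _ _ _]/= [count _ _]/= eqbF_neg -ltnNge.
have := IH (r - u)%R; have := val_subr_Zp u r.
rewrite mulrS opprD addrA (mulnS u) mulnDl => E1 E2.
by rewrite addnAC -E1 addnC addnA E2 [in RHS](addnC (nat_of_ord u)) addnA.
Qed.

(** By the conservation law, n times the difference of the two counts is the sum
    of two differences of elements of [0, n), hence less than 2n. *)
Lemma rotation_word_balanced n (u r s : 'I_n.+2) l :
  count_mem false (rotation_word u r l)
    <= (count_mem false (rotation_word u s l)).+1.
Proof.
rewrite -ltnS -(@ltn_pmul2r n.+2) // !mulSn.
have := count_rotation_word u r l; have := count_rotation_word u s l.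
have := ltn_ord s; have := ltn_ord (r - u *+ l)%R.
move: (_ * n.+2) (_ * n.+2) (u * l) => x y z.
by move: (nat_of_ord (r - _)%R) (nat_of_ord (s - _)%R) => r' s'; lia.
Qed.

(** While both orbits read the same letter, both or none wrap around and the
    distance s - r persists. At the first disagreement the lower orbit is the one
    below u, and reads the smaller letter. A disagreement must come before the
    lower orbit reaches n - 1, since nothing lies above. *)
Lemma rotation_word_lt n (u r s : 'I_n.+2) l t : t < l ->
  (r - u *+ t)%R = ord_max -> r < s ->
  (rotation_word u r l < rotation_word u s l)%O.
Proof.
elim: l r s t => //= l IH r s t lt_tl Et lt_rs.
have lt_sn := ltn_ord s.
rewrite ltxi_cons.
case: t lt_tl Et => [_|t lt_tl Et].
  by rewrite mulr0n subr0 => Er; move: lt_rs; rewrite Er /=; lia.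
have Er := val_subr_Zp u r; have Es := val_subr_Zp u s.
have IHt : (r < u) = (s < u) ->
    (rotation_word u (r - u)%R l < rotation_word u (s - u)%R l)%O.
  move=> E; apply: (IH _ _ t) => //; last by rewrite E in Er; lia.
  by rewrite -Et mulrS opprD addrA.
move: IHt; rewrite !(leqNgt u).
by case: (ltnP r u) => lt_ru; case: (ltnP s u) => lt_su //=;
  [apply | lia | apply].
Qed.

Lemma unit_rotation_transitive n (u r s : 'I_n.+2) : u \is a GRing.unit ->
  exists2 t, t < n.+2 & (r - u *+ t)%R = s.
Proof.
move=> Uu; exists (u^-1 * (r - s) : 'I_n.+2)%R; first exact: ltn_ord.
by rewrite -mulr_natr natr_Zp mulrA divrr // mul1r opprB addrC subrK.
Qed.

Lemma unit_rotation_word_lt n (u r s : 'I_n.+2) : u \is a GRing.unit ->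
  r < s -> (rotation_word u r n.+2 < rotation_word u s n.+2)%O.
Proof.
move=> Uu lt_rs; have [t lt_tn Et] := unit_rotation_transitive r ord_max Uu.
exact: rotation_word_lt lt_tn Et lt_rs.
Qed.

Lemma unit_Zp_gt0 n (u : 'I_n.+2) : u \is a GRing.unit -> 0 < u.
Proof.
by apply: contraTT; rewrite -eqn0Ngt => /eqP u0; rewrite -(natr_Zp u) u0 unitr0.
Qed.

Lemma coprime_unit_Zp n (u : 'I_n.+2) : u \is a GRing.unit -> coprime u n.+2.
Proof. by rewrite -{1}(natr_Zp u) (@unitZpE n.+2) // coprime_sym. Qed.

(** * Christoffel words and their sorted conjugates *)

Lemma rotation_word_christoffel n (u : 'I_n.+2) : u \is a GRing.unit ->
  christoffel_word_of n.+2 u (rotation_word u 0%R n.+2).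
Proof.
move=> Uu; have u_gt0 := unit_Zp_gt0 Uu.
have Ecount : count_mem false (rotation_word u 0%R n.+2) = u.
  have := count_rotation_word u 0%R n.+2.
  rewrite mulrn_order_Zp subr0 /= addn0 add0n => /eqP.
  by rewrite eqn_pmul2r // => /eqP.
split=> //; last first.
- have := count_predC (pred1 false) (rotation_word u 0%R n.+2).
  rewrite Ecount size_rotation_word => /(canRL (addKn _)) <-.
  by apply: eq_count; case.
- by apply/negbTE; rewrite -ltnNge.
- exact: size_rotation_word.
split=> [k | i j l]; rewrite size_rotation_word.
  case/andP=> k_gt0 lt_kn; rewrite rot_rotation_word; last exact: ltnW.
  apply: unit_rotation_word_lt => //.
  rewrite lt0n; apply/negP => /eqP E.
  have {E} : (0 - u *+ k)%R = 0%R :> 'I_n.+2 by exact: val_inj.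
  rewrite sub0r => /eqP; rewrite oppr_eq0 -mulr_natr => /eqP.
  move/(congr1 ( *%R u^-1)%R).
  rewrite mulKr // mulr0 => /(congr1 val); rewrite /= (@val_Zp_nat n.+2) //.
  by rewrite modn_small //; lia.
move=> /ltnW lt_in /ltnW lt_jn le_ln; rewrite !rot_rotation_word //.
rewrite !take_rotation_word //.
exact: rotation_word_balanced.
Qed.

(** Starting points ordered by value give a sorted list of rows, and this list
    is a permutation of the conjugates because a unit generates Z/nZ. *)
Lemma sorted_conjugates_rotation_word n (u : 'I_n.+2) : u \is a GRing.unit ->
  sorted_conjugates (rotation_word u 0%R n.+2)
    = [seq rotation_word u r n.+2 | r <- enum 'I_n.+2].
Proof.
move=> Uu; apply: (@sorted_eq _ (fun v w : word => (v <= w)%O)).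
- exact: le_trans.
- exact: le_anti.
- exact/sort_sorted/le_total.
- rewrite sorted_map.
  have: sorted ltn (map val (enum 'I_n.+2)).
    by rewrite val_enum_ord iota_ltn_sorted.
  rewrite sorted_map; apply: sub_sorted => r s /= lt_rs.
  exact/ltW/unit_rotation_word_lt.
rewrite perm_sort size_rotation_word.
have -> : [seq (rot k (rotation_word u 0%R n.+2) : word) | k <- iota 0 n.+2]
   = [seq rotation_word u r n.+2
       | r <- [seq (- (u *+ k))%R | k <- iota 0 n.+2]].
  rewrite -map_comp; apply/eq_in_map => k; rewrite mem_iota /= add0n => lt_kn.
  by rewrite [LHS](rot_rotation_word u 0%R (ltnW lt_kn)) sub0r.
apply: perm_map; rewrite perm_sym; apply: uniq_perm.
- exact: enum_uniq.
- apply: (@leq_size_uniq _ (enum 'I_n.+2)).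
  + exact: enum_uniq.
  + move=> r _; have [t lt_tn <-] := unit_rotation_transitive 0%R r Uu.
    by rewrite sub0r; apply/mapP; exists t; rewrite ?mem_iota.
  + by rewrite size_map size_iota size_enum_ord.
move=> r; rewrite mem_enum inE; apply/esym.
have [t lt_tn <-] := unit_rotation_transitive 0%R r Uu.
by rewrite sub0r; apply/mapP; exists t; rewrite ?mem_iota.
Qed.

(** * Multiplying Christoffel matrices *)

Lemma count_rotation_wordE n (u r : 'I_n.+2) l :
  count_mem false (rotation_word u r l) = \sum_(t < l) ((r - u *+ t)%R < u).
Proof.
elim: l r => [|l IH] r; first by rewrite big_ord0.
rewrite [rotation_word _ _ _]/= [count _ _]/= eqbF_neg -ltnNge IH.
rewrite big_ord_recl mulr0n subr0; congr (_ + _).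
by apply: eq_bigr => t _; rewrite lift0 mulrS opprD addrA.
Qed.

Lemma sum_ltn_Zp n (u : 'I_n.+2) (F : 'I_n.+2 -> nat) :
  \sum_j F j * (j < u) = \sum_(t < u) F (t%:R)%R.
Proof.
transitivity (\sum_(j < n.+2 | j < u) F j).
  rewrite [RHS]big_mkcond; apply: eq_bigr => j _.
  by case: ifP; rewrite ?muln1 ?muln0.
rewrite (big_ord_narrow (ltnW (ltn_ord u))); apply: eq_bigr => t _.
by rewrite -[in LHS](natr_Zp (widen_ord _ t)).
Qed.

Lemma sum_christoffel_row n (u i : 'I_n.+2) :
  \sum_(j < n.+2) ((i - u * j)%R < u) = u.
Proof.
have := count_rotation_word u i n.+2.
rewrite mulrn_order_Zp subr0 addnC => /addnI/eqP.
rewrite eqn_pmul2r // => /eqP Ecount.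
rewrite -[RHS]Ecount count_rotation_wordE; apply: eq_bigr => j _.
by rewrite -[in LHS](natr_Zp j) mulr_natr.
Qed.

Lemma sum_christoffel_col n (u c : 'I_n.+2) :
  \sum_(j < n.+2) ((j - c)%R < u) = u.
Proof.
rewrite (reindex_inj (h := fun j => (j + c)%R) (addIr c)).
under eq_bigr => j _ do rewrite addrK -[nat_of_bool _]mul1n.
by rewrite (sum_ltn_Zp u (fun=> 1)) sum1_card card_ord.
Qed.

(** This is entry (i, k) of the product of the 0-1 matrices of u and v. Shifting
    j by v k turns the sum into the number of visits to [0, u) during v steps of
    the rotation by u started at i - u v k, and the conservation law evaluates it
    by comparing u v with its residue. *)
Lemma sum_christoffel_row_col n (u v i k : 'I_n.+2) :
  \sum_(j < n.+2) ((i - u * j)%R < u) * ((j - v * k)%R < v)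
    = (u * v) %/ n.+2 + ((i - (u * v) * k)%R < (u * v)%R).
Proof.
set r : 'I_n.+2 := (i - u * v * k)%R; set w : 'I_n.+2 := (u * v)%R.
have Ew : w = (u * v) %% n.+2 :> nat by [].
rewrite (reindex_inj (h := fun j => (j + v * k)%R) (addIr (v * k)%R)).
under eq_bigr => j _ do
  rewrite addrK mulrDr (addrC (u * j)%R) mulrA opprD addrA.
rewrite (sum_ltn_Zp v (fun j => (r - u * j)%R < u)).
under eq_bigr => j _ do rewrite mulr_natr.
rewrite -count_rotation_wordE.
have := count_rotation_word u r v; have := val_subr_Zp w r.
rewrite -(mulr_natr u v) natr_Zp -/w => E1 E2.
apply/eqP; rewrite -(@eqn_pmul2r n.+2) // mulnDl -(eqn_add2r r) E2.
by rewrite -addnA -E1 addnCA Ew -divn_eq.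
Qed.

Local Open Scope ring_scope.

Definition christoffel01_mx (F : fieldType) n (u : 'I_n.+2) : 'M[F]_n.+2 :=
  \matrix_(i, j) ((i - u * j)%R < u)%N%:R.

(** The additive constant makes every row sum equal to 1. *)
Definition normalized_christoffel_mx (F : fieldType) n (u : 'I_n.+2) :
    'M[F]_n.+2 :=
  const_mx ((1 - u%:R) / n.+2%:R) + christoffel01_mx F u.

Lemma normalized_christoffel_mxP (F : fieldType) n (u : 'I_n.+2) :
  u \is a GRing.unit -> is_christoffel_mx (normalized_christoffel_mx F u).
Proof.
move=> Uu; pose b : F := (1 - u%:R) / n.+2%:R.
exists (u : nat), (rotation_word u 0 n.+2), (b + 1), b; split.
- exact: ltn_ord.
- exact: coprime_unit_Zp.
- exact: rotation_word_christoffel.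
- by rewrite -subr_eq0 addrC addKr oner_eq0.
apply/matrixP => i j; rewrite !mxE sorted_conjugates_rotation_word //.
rewrite (nth_map i) ?size_enum_ord // nth_ord_enum nth_rotation_word //.
by rewrite -(mulr_natr u) natr_Zp -/b; case: leqP => _ //=; exact: addr0.
Qed.

Lemma normalized_christoffel_mxE (F : fieldType) n (u i j : 'I_n.+2) :
  normalized_christoffel_mx F u i j
    = (1 - u%:R) / n.+2%:R + ((i - u * j)%R < u)%N%:R.
Proof. by rewrite !mxE. Qed.

(** Both sides have the form x J + P_(uv) with J the matrix of ones; the two
    values of x agree by the Euclidean division of u v by n. *)
Lemma normalized_christoffel_mxM (F : fieldType) n (u v : 'I_n.+2) :
  n.+2%:R != 0 :> F ->
  normalized_christoffel_mx F (u * v)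
    = normalized_christoffel_mx F u *m normalized_christoffel_mx F v.
Proof.
move=> Nn0; apply/matrixP => i k; rewrite normalized_christoffel_mxE [RHS]mxE.
under eq_bigr => j _ do
  rewrite !normalized_christoffel_mxE mulrDl !mulrDr -natrM.
have sumD (f g : 'I_n.+2 -> F) : \sum_j (f j + g j) = \sum_j f j + \sum_j g j.
  exact: big_split.
rewrite !sumD -!mulr_suml -!mulr_sumr sumr_const card_ord.
rewrite -!natr_sum sum_christoffel_row sum_christoffel_col.
rewrite sum_christoffel_row_col natrD !addrA; congr (_ + _).
have := congr1 (fun m => m%:R : F) (divn_eq (u * v) n.+2).
rewrite natrM natrD natrM -[(_ %% _)%N]/(nat_of_ord (u * v)%R).
move: (_ %/ _)%N => q E.
have -> : (u * v)%R%:R = u%:R * v%:R - q%:R * n.+2%:R :> F.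
  by rewrite E addrC addKr.
by rewrite -mulr_natr; field; rewrite -natrD.
Qed.

Lemma normalized_christoffel_mx1 (F : fieldType) n :
  normalized_christoffel_mx F (1 : 'I_n.+2) = 1%:M.
Proof.
apply/matrixP => i j; rewrite !mxE subrr mul0r add0r mul1r.
by congr (_ %:R); rewrite ltnS leqn0 -subr_eq0.
Qed.

(** If u > 1, the first two entries of the first column are equal, which is not
    the case for the identity matrix. *)
Lemma normalized_christoffel_mx_eq1 (F : fieldType) n (u : 'I_n.+2) :
  u \is a GRing.unit -> normalized_christoffel_mx F u = 1%:M -> u = 1.
Proof.
move=> /unit_Zp_gt0 u_gt0 /matrixP E; apply: val_inj => /=.
have := E 0 0; have := E 1 0.
rewrite !normalized_christoffel_mxE !mxE !mulr0 !subr0 eqxx.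
rewrite u_gt0 => E1 /(canRL (addrK _)); rewrite subrr => E0; move: E1.
rewrite E0 add0r /=; case: ltnP => [_ /eqP | ]; first by rewrite oner_eq0.
by rewrite modn_small //; lia.
Qed.

Local Close Scope ring_scope.

(** * Embedding finite abelian groups in units modulo n *)

Lemma expn_mod_period N u d k :
  u ^ d = 1 %[mod N] -> u ^ k = u ^ (k %% d) %[mod N].
Proof.
move=> ud; rewrite {1}(divn_eq k d) expnD mulnC [_ * d]mulnC expnM -modnMmr.
by rewrite -modnXm ud modnXm exp1n modnMmr muln1.
Qed.

(** Take N = 1 + u + ... + u^(d-1), a divisor of u^d - 1: the powers u^r with
    0 < r < d lie strictly between 1 and N, so none is 1 modulo N. As N is 1
    modulo u, it is prime to every divisor of u. *)
Lemma unit_of_order M d : 0 < M -> 0 < d ->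
  exists N u, [/\ 0 < N, coprime N M
    & forall k, (u ^ k == 1 %[mod N]) = (d %| k)].
Proof.
(* The factor 2 ensures 1 < u when M = 1. *)
move=> M_gt0 d_gt0; pose u := 2 * M; pose N := \sum_(j < d) u ^ j.
have EN : N = 1 + \sum_(j < d.-1) u ^ j.+1.
  by rewrite /N -[in LHS](prednK d_gt0) big_ord_recl expn0.
have u_gt1 : 1 < u by rewrite /u; lia.
have ud : u ^ d = 1 %[mod N].
  apply/eqP; rewrite eqn_mod_dvd ?expn_gt0 ?(ltnW u_gt1) //.
  by rewrite subn1 predn_exp dvdn_mull.
have lt_uN r : 0 < r < d -> u ^ r < N.
  case: r => // r lt_rd; rewrite EN add1n ltnS.
  have lt_rd1 : r < d.-1 by lia.
  by rewrite (bigD1 (Ordinal lt_rd1)) //= leq_addr.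
exists N, u; split=> [||k].
- by rewrite EN.
- rewrite coprime_sym.
  have : coprime u N.
    rewrite EN; under eq_bigr => j _ do rewrite expnS.
    by rewrite -big_distrr /= addnC mulnC /coprime gcdnMDl gcdn1.
  exact/coprime_dvdl/dvdn_mull.
rewrite (expn_mod_period k ud).
rewrite /dvdn; have := ltn_pmod k d_gt0; move: (k %% d) => r lt_rd.
have [->|r_gt0] := posnP r; first by rewrite expn0 !eqxx.
have lt_urN : u ^ r < N by rewrite lt_uN // r_gt0.
have gt1 : 1 < u ^ r by rewrite -(expn0 u) ltn_exp2l.
rewrite !modn_small //; last exact: ltn_trans lt_urN.
exact: gtn_eqF.
Qed.

(** Injective morphisms to the units of Z/NZ, encoded with integer values so that
    N = 1 is allowed and the Chinese remainder theorem on integers applies. *)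
Definition embeds_mod (gT : finGroupType) (G : {set gT}) N (f : gT -> nat) :=
  [/\ {in G &, forall x y, f (x * y)%g = f x * f y %[mod N]},
      f 1%g = 1 %[mod N]
    & {in G, forall x, f x = 1 %[mod N] -> x = 1%g}].

Lemma cycle_embeds_mod (gT : finGroupType) (x : gT) M : 0 < M ->
  exists N f, [/\ 0 < N, coprime N M & embeds_mod <[x]>%g N f].
Proof.
move=> M_gt0; have [N [u [N_gt0 coNM u_order]]] :=
  unit_of_order M_gt0 (order_gt0 x).
have log_ex y : exists i : nat, y \in <[x]>%g -> y = (x ^+ i)%g.
  case: (boolP (y \in <[x]>%g)) => [/cycleP[i ->]|_]; first by exists i.
  by exists 0.
have [e He] := fin_all_exists log_ex.
have eq_mod i j : (x ^+ i)%g = (x ^+ j)%g -> u ^ i = u ^ j %[mod N].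
  have ud : u ^ #[x]%g = 1 %[mod N] by apply/eqP; rewrite u_order.
  move/eqP; rewrite eq_expg_mod_order => /eqP Eij.
  by rewrite (expn_mod_period i ud) Eij -(expn_mod_period j ud).
exists N, (fun y => u ^ e y); split=> //; split=> [y z yx zx | | y yx].
- by rewrite -expnD; apply: eq_mod; rewrite expgD -!He ?groupM.
- by rewrite -(expn0 u); apply: eq_mod; rewrite expg0 -He ?group1.
by move/eqP; rewrite u_order order_dvdn => /eqP; rewrite -He.
Qed.

(** Induction along a decomposition into cyclic factors: the modulus of a new
    factor is chosen prime to the modulus already built and to M. *)
Lemma abelian_embeds_mod (gT : finGroupType) (G : {group gT}) M :
  abelian G -> 0 < M ->
  exists N f, [/\ 1 < N, coprime N M & embeds_mod G N f].
Proof.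
move=> abG M_gt0; have [b defG _] := abelian_structure abG.
elim: b G {abG} defG => [|x b IH] G.
  (* M + 1 is a modulus greater than 1 and prime to M. *)
  rewrite big_nil => defG; exists M.+1, (fun=> 1); split=> //.
    exact: coprimeSn.
  by split=> // y; rewrite -defG => /set1P.
rewrite big_cons => defG; have [[_ H _ defH] defKH cKH tiKH] := dprodP defG.
rewrite defH in defG defKH cKH tiKH.
have [N [f [N_gt1 coNM [fM f1 f_inj]]]] := IH H defH.
have NM_gt0 : 0 < N * M by rewrite muln_gt0 M_gt0 ltnW.
have [K [h [K_gt0]]] := cycle_embeds_mod x NM_gt0.
rewrite coprimeMr => /andP[coKN coKM] [hM h1 h_inj].
have complH : H \in [complements to <[x]> in G]%g by apply/complP.
pose p := divgr <[x]>%g H; pose q := remgr <[x]>%g H.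
have pG y : y \in G -> p y \in <[x]>%g by rewrite -defKH; apply: mem_divgr.
have qG y : y \in G -> q y \in H by rewrite -defKH; apply: mem_remgr.
have pM : {in G &, {morph p : y z / y * z}}%g by apply: divgrM.
have qM : {in G &, {morph q : y z / y * z}}%g.
  by apply: remgrM => //; case/sdprod_context: (dprodWsd defG).
have p1 : p 1%g = 1%g by apply: (mulgI (p 1%g)); rewrite -pM ?group1 // !mulg1.
have q1 : q 1%g = 1%g by apply: (mulgI (q 1%g)); rewrite -qM ?group1 // !mulg1.
exists (K * N), (fun y => chinese K N (h (p y)) (f (q y))); split.
- by rewrite (leq_trans N_gt1) // leq_pmull.
- by rewrite coprimeMl coKM.
have crt y z : y = z %[mod K] -> y = z %[mod N] -> y = z %[mod K * N].
  by move=> /eqP eK /eqP eN; apply/eqP; rewrite chinese_remainder // eK.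
split=> [y z yG zG | | y yG].
- apply: crt; rewrite -modnMm ?(chinese_modl coKN) ?(chinese_modr coKN) modnMm.
    by rewrite pM // hM ?pG.
  by rewrite qM // fM ?qG.
- by apply: crt; rewrite ?(chinese_modl coKN) ?(chinese_modr coKN) ?p1 ?q1.
move/eqP; rewrite chinese_remainder // => /andP[].
rewrite (chinese_modl coKN) (chinese_modr coKN) => /eqP hy /eqP fy.
rewrite (divgr_eq <[x]>%g H y) -/(p y) -/(q y).
by rewrite (h_inj _ (pG _ yG) hy) (f_inj _ (qG _ yG) fy) mulg1.
Qed.

(** * Representations by Christoffel matrices *)

Lemma christoffel_representation (F : finFieldType) (gT : finGroupType)
    (G : {group gT}) : abelian G ->
  exists (n : nat) (rG : mx_representation F G n),
     [/\ 2 <= n, mx_faithful rG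
       & forall x : gT, x \in G ->
           rG x \in unitmx /\ is_christoffel_mx (rG x)].
Proof.
move=> abG; have [p p_pr charF] := finPcharP F.
have [N [f [N_gt1 coNp [fM f1 f_inj]]]] :=
  abelian_embeds_mod abG (prime_gt0 p_pr).
case: N => [|[|n]] // in N_gt1 coNp fM f1 f_inj *.
pose u x : 'I_n.+2 := ((f x)%:R)%R.
have eq_u x m : (u x = m%:R :> 'I_n.+2)%R <-> f x = m %[mod n.+2].
  have Eu : val (u x) = f x %% n.+2 by apply: (@val_Zp_nat n.+2).
  have Em : val (m%:R : 'I_n.+2)%R = m %% n.+2 by apply: (@val_Zp_nat n.+2).
  by rewrite -Eu -Em; split=> [->|/val_inj].
have uM : {in G &, forall x y, u (x * y)%g = (u x * u y)%R}.
  by move=> x y xG yG; rewrite -natrM; apply/eq_u/fM.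
have u1 : u 1%g = 1%R by apply/(eq_u _ 1).
have Uu x : x \in G -> u x \is a GRing.unit.
  move=> xG; apply/unitrPr; exists (u x^-1%g).
  by rewrite -uM ?groupV // mulgV.
have Nn0 : (n.+2%:R != 0 :> F)%R.
  by rewrite -(dvdn_pcharf charF) -prime_coprime // coprime_sym.
have mxP : mx_repr G (fun x => normalized_christoffel_mx F (u x)).
  split=> [|x y xG yG]; first by rewrite u1 normalized_christoffel_mx1.
  by rewrite uM // normalized_christoffel_mxM.
pose rG := MxRepresentation mxP.
exists n.+2, rG; split=> // [|x xG].
  apply/subsetP => x /rkerP[xG rx1]; apply/set1P/f_inj => //.
  by apply/(eq_u x 1); apply: normalized_christoffel_mx_eq1 rx1; apply: Uu.
split; first exact: (repr_mx_unit rG).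
exact/normalized_christoffel_mxP/Uu.
Qed.

Theorem corollary5 (F : finFieldType) (gT : finGroupType) (G : {group gT})
    (abG : abelian G) :
  (exists (n : nat) (rG : mx_representation F G n),
     [/\ 2 <= n,
         mx_faithful rG
       & forall x : gT, x \in G ->
           rG x \in unitmx /\ is_christoffel_mx (rG x)])
  /\
  (exists (n : nat) (rG : mx_representation 'F_2 G n),
     [/\ 2 <= n,
         #|[set rG x | x in G]| = #|G|
       & forall x : gT, x \in G ->
           rG x \in unitmx /\ is_christoffel_mx (rG x)]).
Proof.
split; first exact: christoffel_representation.
have [n [rG [n_gt1 faithG chrG]]] := christoffel_representation 'F_2 abG.
by exists n, rG; split=> //; apply/card_in_imset/mx_faithful_inj.
Qed.
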